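(* For all integers $t \geq s \geq 2$ there exists a constant $C = C(t) > 0$, depending only on $t$, such that the following holds. Let $\varepsilon > 0$, let $H$ be an ordered $s$-uniform matching on $t$ vertices, and let $G$ be an ordered $s$-uniform hypergraph on $n$ vertices. If $G$ is $\varepsilon$-far from being $H$-free, then $G$ contains at least $(\varepsilon/C)^C n^t$ copies of $H$.
   Context: An ordered $s$-uniform hypergraph is a (finite) $s$-uniform hypergraph together with a linear ordering of its vertex set (for $s=2$ this is an ordered graph). An ordered $s$-uniform matching on $t$ vertices is an ordered $s$-uniform hypergraph with $t$ vertices in which every vertex belongs to exactly one edge (so it has $t/s$ pairwise disjoint edges). A copy of an ordered $s$-uniform hypergraph $H$ in an ordered $s$-uniform hypergraph $G$ is an injection $\varphi : V(H) \to V(G)$ which preserves the vertex order and satisfies $\varphi(e) \in E(G)$ for every $e \in E(H)$. $G$ is $H$-free if it contains no copy of $H$. An $n$-vertex ordered $s$-uniform hypergraph $G$ is $\varepsilon$-far from being $H$-free if one has to delete at least $\varepsilon n^s$ edges of $G$ to turn it into an $H$-free hypergraph. *)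

(* Defs.v *)
From mathcomp Require Import all_boot all_order all_algebra.
From mathcomp Require Import reals exp.

Set Implicit Arguments.
Unset Strict Implicit.
Unset Printing Implicit Defensive.

Import Order.TTheory GRing.Theory Num.Theory.

Local Open Scope ring_scope.

(* A hypergraph on the vertex type V is given by its edge set; the vertex
   order of an ordered hypergraph is the order of a [finOrderType]. *)
Definition is_uniform (s : nat) (V : finType) (E : {set {set V}}) : bool :=
  [forall e in E, #|e| == s].

Definition is_matching (s : nat) (V : finType) (E : {set {set V}}) : bool :=
  is_uniform s E && [forall v, #|[set e in E | v \in e]| == 1%N].

Section Copies.

Variables (dU dV : Order.disp_t) (U : finOrderType dU) (V : finOrderType dV).

Implicit Types (H : {set {set U}}) (G : {set {set V}}).

Definition is_copy H G (phi : {ffun U -> V}) : bool :=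
  [&& injectiveb phi,
      [forall x, forall y, (x < y)%O ==> (phi x < phi y)%O]
    & [forall e in H, phi @: e \in G]].

(* Copies are counted as maps, not as subhypergraphs of G. *)
Definition copies H G : {set {ffun U -> V}} := [set phi | is_copy H G phi].

Definition is_free H G : Prop := ~ exists phi : {ffun U -> V}, is_copy H G phi.

Definition is_far (R : realType) (eps : R) (s : nat) H G : Prop :=
  forall D : {set {set V}}, D \subset G -> is_free H (G :\: D) ->
    eps * #|V|%:R ^+ s <= #|D|%:R.

End Copies.

(* Main.v *)
(* Fix an integer M and cut the vertex order of G into nested cells of scales
   0, ..., t, each cell of scale j being divided into M cells of scale j + 1.
   First delete the edges of G lying in a poor box, i.e. a product of s cells of
   scale t containing few edges.  Then, for each edge f of H with vertices of
   ranks p_1 < ... < p_s in H, delete every remaining edge e such that no other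
   remaining edge e' has its k-th vertex, for all k, in the same cell of scale
   p_k as that of e but in a strictly smaller cell of scale p_k + 1.  Inside a
   product of cells of scales p_k, the deleted edges meet at most one
   subbox of each diagonal, so only O(n^s / M) edges are lost.  With M of order
   1 / eps a copy of H survives.  Replace each of its edges e by e': if x < y are
   consecutive vertices of the copy, x of rank p, then x moves to a smaller cell
   of scale p + 1 while y keeps its cell of scale p + 1, so the new vertices lie
   in strictly increasing cells.  Hence arbitrary edges from the (rich) boxes of
   the new edges always form a copy of H. *)
Require Import Defs.
From mathcomp Require Import all_boot all_order all_algebra.
From mathcomp Require Import reals exp.
From mathcomp Require Import zify ring lra.

Import Order.TTheory GRing.Theory Num.Theory.

Local Open Scope ring_scope.

Set Implicit Arguments.
Unset Strict Implicit.
Unset Printing Implicit Defensive.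

Local Open Scope nat_scope.

(** * Ranks and increasing enumerations *)

Definition rk (d : Order.disp_t) (T : finOrderType d) (x : T) : 'I_#|T| :=
  Order.enum_rank x.

Lemma rk_inj (d : Order.disp_t) (T : finOrderType d) : injective (@rk d T).
Proof. exact: Order.enum_rank_inj. Qed.

Lemma ltn_rk (d : Order.disp_t) (T : finOrderType d) (x y : T) :
  (rk x < rk y) = (x < y)%O.
Proof.
have -> : (rk x < rk y) = (rk x < rk y)%O by [].
by rewrite (leW_mono (Order.le_enum_rank (@le_total d T))).
Qed.

Lemma increasing_enumeration (d : Order.disp_t) (T : finOrderType d)
    (s : nat) (A : {set T}) : #|A| = s ->
  exists h : {ffun 'I_s -> T},
    (forall i j : 'I_s, i < j -> (h i < h j)%O) /\ h @: setT = A.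
Proof.
move=> <-; exists [ffun i => Order.enum_val i]; split=> [i j ij|].
  by rewrite !ffunE (leW_mono (Order.le_enum_val (@le_total d T) (A := mem A))).
apply/setP=> x; apply/imsetP/idP => [[i _ ->]|Ax].
  by rewrite ffunE Order.enum_valP.
by exists (Order.enum_rank_in Ax x); rewrite ?inE // ffunE Order.enum_rankK_in.
Qed.

(** * Counting edges that do not dominate one another *)

Lemma leq_card_bigcup (I T : finType) (F : I -> {set T}) :
  #|\bigcup_i F i| <= \sum_i #|F i|.
Proof.
elim/big_rec2: _ => [|i n A _ le]; first by rewrite cards0.
by rewrite (leq_trans (leq_card_setU _ _).1) ?leq_add2l.
Qed.

(* [r] is determined by [r + c * w] for [c < M], because the digit of [r] in
   question vanishes. *)
Lemma card_zero_digit (n w M : nat) : 0 < w -> w * M <= n ->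
  #|[set r : 'I_n | (r %/ w) %% M == 0]| * M <= 2 * n.
Proof.
move=> w0 wMn.
pose A := [set r : 'I_n | (r %/ w) %% M == 0].
have lt_shift (x : 'I_n * 'I_M) : x.1 + x.2 * w < 2 * n.
  have := ltn_ord x.1; have := ltn_ord x.2 => h1 h2.
  have h3 : x.2 * w <= w * M by rewrite mulnC leq_mul2l ltnW ?orbT.
  by lia.
pose F x := Ordinal (lt_shift x).
have Finj : {in setX A [set: 'I_M] &, injective F}.
  move=> [r c] [r' c']; rewrite !in_setX !inE !andbT /= => /eqP r0 /eqP r0'.
  move=> /(congr1 val) /= e.
  have ec : c = c' :> nat.
    have := congr1 (fun m => (m %/ w) %% M) e.
    rewrite /= [in LHS]addnC [in RHS]addnC !divnMDl //.
    by rewrite -modnDmr r0 addn0 -[in RHS]modnDmr r0' addn0 !modn_small.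
  move: e; rewrite ec => /addIn e.
  by congr pair; apply: val_inj.
have := card_in_imset Finj; rewrite cardsX cardsT card_ord => <-.
by apply: leq_trans (max_card _) _; rewrite card_ord.
Qed.

(* Subtracting the smallest digit from all digits is injective on [S], and it
   makes one of the digits vanish. *)
Lemma card_undominated (s n M : nat) (V : finType) (r : V -> 'I_n)
    (w : 'I_s -> nat) (S : {set {ffun 'I_s -> V}}) :
  0 < s -> injective r -> (forall k, 0 < w k) -> (forall k, w k * M <= n) ->
  (forall g g', g \in S -> g' \in S ->
     (forall k, r (g' k) %/ (w k * M) = r (g k) %/ (w k * M)) ->
     (forall k, r (g' k) %/ w k < r (g k) %/ w k) -> False) ->
  #|S| * M <= 2 * s * n ^ s.
Proof.
case: s w S => // s w S _ r_inj w0 wM nodom.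
case: (posnP M) => [->|M0]; first by rewrite muln0.
(* [dig g k] is the position of the cell of width [w k] around [g k] among the [M] subcells of its
   larger cell. *)
pose dig (g : {ffun 'I_s.+1 -> V}) k := (r (g k) %/ w k) %% M.
pose k0 (g : {ffun 'I_s.+1 -> V}) := [arg min_(k < ord0 | true) dig g k].
have k0P g k : dig g (k0 g) <= dig g k.
  by rewrite /k0; case: arg_minnP => // i _; apply.
pose mu g := dig g (k0 g).
have muw g k : mu g * w k <= r (g k).
  apply: leq_trans (leq_trunc_div _ (w k)); rewrite leq_mul2r.
  by apply/orP; right; apply: leq_trans (k0P g k) (leq_mod _ _).
have lt_z (g : {ffun 'I_s.+1 -> V}) k : r (g k) - mu g * w k < n.
  by apply: leq_ltn_trans (leq_subr _ _) (ltn_ord _).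
pose z g : {ffun 'I_s.+1 -> 'I_n} := [ffun k => Ordinal (lt_z g k)].
have zE (g : {ffun 'I_s.+1 -> V}) k : r (g k) = z g k + mu g * w k :> nat.
  by rewrite ffunE /= subnK.
have zdiv (g : {ffun 'I_s.+1 -> V}) k : r (g k) %/ w k = z g k %/ w k + mu g.
  by rewrite zE addnC divnMDl // addnC.
have zdig (g : {ffun 'I_s.+1 -> V}) k : (z g k %/ w k) %/ M = (r (g k) %/ w k) %/ M.
  have e := divn_eq (r (g k) %/ w k) M.
  have h := k0P g k; have h' : dig g k < M by rewrite ltn_mod.
  have -> : z g k %/ w k = (r (g k) %/ w k) %/ M * M + (dig g k - mu g).
    have := zdiv g k; rewrite /mu; rewrite {1}e -/(dig g k).
    by lia.
  by rewrite divnMDl // (@divn_small (_ - _)) ?addn0 // (leq_ltn_trans (leq_subr _ _)).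
(* If [z g = z g'], the large cells agree in all coordinates, so a smaller minimal digit lowers
   every subcell, which [nodom] forbids. *)
have nolt g g' : g \in S -> g' \in S -> z g = z g' -> ~ mu g' < mu g.
  move=> gS g'S ez lt; apply: (nodom g g') => // k.
    by rewrite !divnMA -!zdig ez.
  by rewrite !zdiv ez ltn_add2l.
have zinj : {in S &, injective z}.
  move=> g g' gS g'S ez.
  have emu : mu g = mu g'.
    by case: (ltngtP (mu g) (mu g')) => // h; case: (nolt _ _ _ _ _ h).
  by apply/ffunP=> k; apply: r_inj; apply: val_inj; rewrite /= !zE ez emu.
pose A k := [set i : 'I_n | (i %/ w k) %% M == 0].
pose B k := [set f : {ffun 'I_s.+1 -> 'I_n} | f k \in A k].
(* The digit at [k0 g] is the one that becomes zero. *)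
have sub : z @: S \subset \bigcup_k B k.
  apply/subsetP=> _ /imsetP[g _ ->]; apply/bigcupP; exists (k0 g) => //.
  rewrite !inE.
  have e := divn_eq (r (g (k0 g)) %/ w (k0 g)) M.
  have -> : z g (k0 g) %/ w (k0 g) = (r (g (k0 g)) %/ w (k0 g)) %/ M * M.
    by have := zdiv g (k0 g); rewrite {1}e -/(dig g (k0 g)) -/(mu g); lia.
  by rewrite modnMl.
have cardB k : #|B k| = #|A k| * n ^ s.
  pose F j : pred 'I_n := if j == k then [in A k] else predT.
  have -> : #|B k| = #|family F|.
    apply: eq_card => f; rewrite inE; apply/idP/familyP => [h j|/(_ k)].
      by rewrite /F; case: eqP => // ->.
    by rewrite /F eqxx.
  rewrite card_family foldrE big_map big_enum /= (bigD1 k) //= /F eqxx.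
  congr (_ * _); rewrite (eq_bigr (fun=> n)).
    by rewrite prod_nat_const cardC1 card_ord.
  by move=> i /negbTE ->; rewrite card_ord.
rewrite -(card_in_imset zinj).
apply: (@leq_trans (\sum_k (#|B k| * M))).
  rewrite -big_distrl /= leq_mul2r; apply/orP; right.
  by apply: leq_trans (subset_leq_card sub) _; apply: leq_card_bigcup.
apply: (@leq_trans (\sum_(k < s.+1) (2 * n * n ^ s))).
  by apply: leq_sum => k _; rewrite cardB mulnAC leq_mul2r card_zero_digit ?orbT.
by rewrite sum_nat_const card_ord mulnA mulnAC expnS; lia.
Qed.

(** * Coordinates on a matching *)

(** Each vertex becomes a pair of an edge and a position in it, so a map on [U] can be assembled
    edge by edge. *)
Lemma matching_coordinates (s : nat) (d : Order.disp_t) (U : finOrderType d)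
    (H : {set {set U}}) : is_matching s H ->
  exists (I : finType) (edge : U -> I) (idx : U -> 'I_s) (h : I -> {ffun 'I_s -> U}),
    [/\ forall u, h (edge u) (idx u) = u,
        forall i k, edge (h i k) = i,
        forall i k, idx (h i k) = k,
        forall i (j k : 'I_s), j < k -> (h i j < h i k)%O
      & forall A : {set U}, A \in H <-> exists i, A = h i @: setT].
Proof.
case/andP=> /forallP unif /forallP match1.
pose I := {f : {set U} | f \in H}.
have /fin_all_exists[h hP] (i : I) : exists h : {ffun 'I_s -> U},
    (forall i j : 'I_s, i < j -> (h i < h j)%O) /\ h @: setT = val i.
  apply: increasing_enumeration; apply/eqP.
  by move/implyP: (unif (val i)); apply; apply: valP.
have hinj i : injective (h i).
  move=> j k e; apply: val_inj => /=.
  by case: (ltngtP j k) => // /(hP i).1; rewrite e ltxx.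
have ex u : exists p : I * 'I_s, h p.1 p.2 = u.
  have /cards1P[f fE] := match1 u.
  have : f \in [set e in H | u \in e] by rewrite fE set11.
  rewrite inE => /andP[fH]; rewrite -[f](SubK {f | f \in H} fH).
  rewrite -(hP (Sub f fH)).2 => /imsetP[k _ ->].
  by exists (Sub f fH, k).
have /fin_all_exists[c cP] := ex.
have uniq u (i i' : I) : u \in val i -> u \in val i' -> i = i'.
  have /cards1P[f fE] := match1 u => ui ui'; apply: val_inj.
  have : val i \in [set e in H | u \in e] by rewrite inE ui (valP i).
  have : val i' \in [set e in H | u \in e] by rewrite inE ui' (valP i').
  by rewrite fE !inE => /eqP -> /eqP ->.
have memh i k : h i k \in val i by rewrite -(hP i).2 imset_f.
have edgeh i k : (c (h i k)).1 = i.
  by apply: (@uniq (h i k)) => //; rewrite -{1}(cP (h i k)).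
exists I, (fun u => (c u).1), (fun u => (c u).2), h; split=> //.
- by move=> i k; apply: (@hinj i); rewrite -{2}(cP (h i k)) edgeh.
- by move=> i j k; apply: (hP i).1.
- move=> A; split=> [AH|[i ->]]; last by rewrite (hP i).2 (valP i).
  by exists (Sub A AH); rewrite (hP _).2.
Qed.

(** * Rich boxes and the deletion argument *)

Definition increasing_edges (s : nat) (d : Order.disp_t) (V : finOrderType d)
    (G : {set {set V}}) : {set {ffun 'I_s -> V}} :=
  [set g : {ffun 'I_s -> V} |
    [forall i : 'I_s, forall j : 'I_s, (i < j) ==> (g i < g j)%O]
    && (g @: setT \in G)].

(** A fiber that contains a poor element has fewer than [a] elements of [A]; every other fiber
    contributes nothing. *)
Lemma card_poor_fibers (R : realType) (T B : finType) (b : T -> B) (A : {set T})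
    (a : R) :
  (0 <= a ->
   #|[set x in A | ~~ (a <= #|[set y in A | b y == b x]|%:R)]|%:R
     <= #|B|%:R * a)%R.
Proof.
move=> a0; set P := [set x in A | _].
rewrite -sum1_card (partition_big b predT) //= natr_sum.
rewrite mulr_natl -sumr_const; apply: ler_sum => y _.
rewrite sum1_card.
have [->|/card_gt0P[x]] := posnP #|[pred i | (i \in P) && (b i == y)]|.
  exact: a0.
rewrite !inE -ltNge => /andP[/andP[xA /ltW le] /eqP bx].
apply: le_trans le; rewrite ler_nat; apply: subset_leq_card.
by apply/subsetP=> z; rewrite !inE bx unfold_in inE => /andP[/andP[-> _] ->].
Qed.

(** A cell of width [w * m] is a union of consecutive cells of width [w]. *)
Lemma ltn_div_multiple (w m x y : nat) :
  x %/ (w * m) < y %/ (w * m) -> x %/ w < y %/ w.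
Proof.
by rewrite !divnMA; apply: contraLR; rewrite -!leqNgt => le; apply: leq_div2r.
Qed.

(* Cells of scale [j] have width [w * M ^ (#|U| - j)], and [w * N] bounds the
   number of vertices so that [N] cells of width [w] suffice. *)
Lemma few_deletions_or_many_copies (R : realType) (s : nat)
    (dU : Order.disp_t) (U : finOrderType dU) (H : {set {set U}})
    (dV : Order.disp_t) (V : finOrderType dV) (G : {set {set V}})
    (M w N : nat) (a : R) :
  0 < s -> is_matching s H -> 0 < M -> 0 < w -> w * M ^ #|U| <= #|V| -> #|V| <= w * N ->
  (0 <= a)%R ->
  exists D : {set {set V}},
    [/\ D \subset G,
        (#|D|%:R * M%:R <= N%:R ^+ s * a * M%:R + (2 * #|U| * #|V| ^ s)%:R)%R
      & ~ is_free H (G :\: D) ->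
        exists2 m, m * s = #|U| & (a ^+ m <= #|copies H G|%:R)%R].
Proof.
move=> s0 Hm M0 w0 wMV VwN a0.
have [I [edge [idx [h [hK edgeh idxh hmono hH]]]]] := matching_coordinates Hm.
have cardU : #|I| * s = #|U|.
  have bij : bijective (fun u => (edge u, idx u)).
    exists (fun p => h p.1 p.2) => [u|[i k]] /=; first exact: hK.
    by rewrite edgeh idxh.
  by rewrite (bij_eq_card bij) card_prod card_ord.
pose width j := w * M ^ (#|U| - j).
have widthS j : j < #|U| -> width j.+1 * M = width j.
  by move=> jU; rewrite /width -mulnA -expnSr subnSK.
have width_dvd j k : j <= k -> k <= #|U| -> width j = width k * M ^ (k - j).
  by move=> jk kU; rewrite /width -mulnA -expnD; congr (_ * _ ^ _); lia.
have width_gt0 j : 0 < width j by rewrite muln_gt0 w0 expn_gt0 M0.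
(* One scale finer than the rank of the vertex: the scale at which that vertex has to move down. *)
pose wd i k := width (rk (h i k)).+1.
have wdM i k : wd i k * M = width (rk (h i k)) by rewrite widthS.
have ltN (g : {ffun 'I_s -> V}) k : rk (g k) %/ w < N.
  by rewrite ltn_divLR // mulnC; apply: leq_trans (ltn_ord _) VwN.
pose box (g : {ffun 'I_s -> V}) : {ffun 'I_s -> 'I_N} :=
  [ffun k => Ordinal (ltN g k)].
pose E := increasing_edges s G.
pose cell g := [set g' in E | box g' == box g].
pose poor := [set g in E | ~~ (a <= #|cell g|%:R)%R].
pose rich := [set g in E | (a <= #|cell g|%:R)%R].
pose dom i (g g' : {ffun 'I_s -> V}) := [forall k,
  (rk (g' k) %/ (wd i k * M) == rk (g k) %/ (wd i k * M))
  && (rk (g' k) %/ wd i k < rk (g k) %/ wd i k)].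
pose stuck i := [set g in rich | [forall g' in rich, ~~ dom i g g']].
pose im (g : {ffun 'I_s -> V}) := g @: setT.
exists (im @: (poor :|: \bigcup_i stuck i)).
have EG g : g \in E -> im g \in G by rewrite inE => /andP[].
have richE g : (g \in rich) = (g \in E) && (a <= #|cell g|%:R)%R.
  by rewrite [LHS]inE.
have poorE g : (g \in poor) = (g \in E) && ~~ (a <= #|cell g|%:R)%R.
  by rewrite [LHS]inE.
have stuckE i g :
    (g \in stuck i) = (g \in rich) && [forall g' in rich, ~~ dom i g g'].
  by rewrite [LHS]inE.
have cellE g g' : (g' \in cell g) = (g' \in E) && (box g' == box g).
  by rewrite [LHS]inE.
split.
- apply/subsetP=> _ /imsetP[g + ->]; rewrite inE => /orP[|/bigcupP[i _]].
    by rewrite poorE => /andP[/EG].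
  by rewrite stuckE richE => /andP[/andP[/EG]].
- have le_poor : (#|poor|%:R <= N%:R ^+ s * a)%R.
    have := card_poor_fibers box E a0.
    by rewrite card_ffun !card_ord natrX.
  (* Stuck edges are rich and have no rich dominator, so none dominates another. *)
  have le_stuck i : #|stuck i| * M <= 2 * s * #|V| ^ s.
    apply: (@card_undominated s #|V| M V (@rk _ V) (wd i)) => //.
    + exact: rk_inj.
    + by move=> k; apply: width_gt0.
    + move=> k; rewrite wdM; apply: leq_trans wMV.
      by rewrite leq_mul2l leq_pexp2l ?leq_subr ?orbT.
    + move=> g g' + + e l; rewrite !stuckE => /andP[_ /forallP/(_ g') /implyP nd] /andP[rg' _].
      have /negP[] := nd rg'.
      by apply/forallP=> k; rewrite e eqxx l.
  have le : #|im @: (poor :|: \bigcup_i stuck i)| <= #|poor| + \sum_i #|stuck i|.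
    apply: leq_trans (leq_imset_card _ _) _.
    apply: leq_trans (leq_card_setU _ _).1 _.
    by rewrite leq_add2l leq_card_bigcup.
  apply: (@le_trans _ _ ((#|poor| + \sum_i #|stuck i|)%:R * M%:R)%R).
    by rewrite ler_wpM2r ?ler0n ?ler_nat.
  rewrite natrD mulrDl lerD ?ler_wpM2r ?ler0n // -natrM ler_nat big_distrl /=.
  apply: (@leq_trans (\sum_(i : I) 2 * s * #|V| ^ s)).
    exact: leq_sum.
  by rewrite sum_nat_const mulnA (mulnCA #|I|) cardU.
move=> nfree.
have /existsP[phi phiP] : [exists phi : {ffun U -> V},
    is_copy H (G :\: im @: (poor :|: \bigcup_i stuck i)) phi].
  by apply: contra_notT nfree => /existsPn none [phi]; apply/negP.
move: phiP => /and3P[_ /forallP phi_mono /forallP phi_edge].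
have {}phi_mono x y : (x < y)%O -> (phi x < phi y)%O.
  by have /forallP/(_ y)/implyP := phi_mono x.
(* An edge of the surviving copy is neither poor nor stuck, hence it has a rich dominator. *)
have phi_rich i : exists g', (g' \in rich) && dom i [ffun k => phi (h i k)] g'.
  set g := [ffun k => _].
  have img : im g = phi @: (h i @: setT).
    rewrite -imset_comp; apply: eq_imset => k; by rewrite ffunE.
  have /implyP := phi_edge (h i @: setT).
  rewrite -img => /(_ ((hH _).2 (ex_intro _ i erefl))).
  rewrite inE => /andP[nD gG].
  have gE : g \in E.
    rewrite inE gG andbT; apply/forallP=> j; apply/forallP=> k; apply/implyP.
    by move=> jk; rewrite !ffunE phi_mono ?hmono.
  have gnD : g \notin poor :|: \bigcup_i stuck i.
    by apply: contra nD => gD; apply: imset_f.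
  have gr : g \in rich.
    rewrite richE gE; apply/negPn/negP => npoor; move: gnD.
    by rewrite inE negb_or poorE gE npoor.
  apply/existsP; apply: contraT => /existsPn all.
  move: gnD; rewrite inE negb_or => /andP[_ /negP[]].
  apply/bigcupP; exists i => //; rewrite stuckE gr; apply/forallP=> g'.
  by apply/implyP=> rg'; have := all g'; rewrite rg'.
have [g' g'P] := fin_all_exists phi_rich.
exists #|I| => //.
(* Choosing any edge in the box of each [g' i] independently and gluing gives at least [a ^+ #|I|]
   maps. *)
pose psi (c : {ffun I -> {ffun 'I_s -> V}}) : {ffun U -> V} :=
  [ffun u => c (edge u) (idx u)].
pose F i := [in cell (g' i)].
have psih c i k : psi c (h i k) = c i k by rewrite ffunE edgeh idxh.
have psi_inj : injective psi.
  by move=> c c' e; apply/ffunP=> i; apply/ffunP=> k; rewrite -!psih e.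
have cardF : (a ^+ #|I| <= #|family F|%:R)%R.
  rewrite card_family foldrE big_map big_enum natr_prod /=.
  rewrite -prodr_const; apply: ler_prod => i _; rewrite a0 /=.
  by have /andP[] := g'P i; rewrite richE => /andP[].
apply: le_trans cardF _; rewrite ler_nat -(card_imset _ psi_inj).
apply: subset_leq_card; apply/subsetP=> _ /imsetP[c /familyP cF ->].
have {}cF i : c i \in cell (g' i) := cF i.
have cE i : c i \in E by have := cF i; rewrite cellE => /andP[].
have cdiv u : rk (psi c u) %/ w = rk (g' (edge u) (idx u)) %/ w.
  have := cF (edge u); rewrite cellE => /andP[_ /eqP/ffunP/(_ (idx u))].
  by rewrite !ffunE => /(congr1 val).
(* At scale [rk u + 1], the cell of the new [u] is below that of [phi u], which is at most that of
   [phi v]; the latter equals that of the new [v], as [rk u + 1 <= rk v]. The strict inequality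
   passes to cells of width [w]. *)
have psi_mono u v : (u < v)%O -> (psi c u < psi c v)%O.
  move=> uv; have ruv := uv; rewrite -ltn_rk in ruv.
  rewrite -ltn_rk; apply: contraTT isT; rewrite -leqNgt => /(leq_div2r w).
  rewrite !cdiv leqNgt => /negP[].
  have /andP[_ /forallP/(_ (idx u))] := g'P (edge u).
  rewrite /wd ffunE hK => /andP[_ lt_u].
  have /andP[_ /forallP/(_ (idx v))] := g'P (edge v).
  rewrite wdM ffunE hK => /andP[/eqP eq_v _].
  have rvU := ltn_ord (rk v).
  have wuE : width (rk u).+1 = w * M ^ (#|U| - (rk u).+1) by [].
  apply: (@ltn_div_multiple _ (M ^ (#|U| - (rk u).+1))); rewrite -wuE.
  apply: leq_trans lt_u _.
  rewrite (width_dvd _ _ ruv (ltnW rvU)) [in leqRHS]divnMA eq_v -divnMA.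
  by apply: leq_div2r; rewrite ltnW // ltn_rk phi_mono.
rewrite inE; apply/and3P; split.
- apply/injectiveP=> u v e.
  by case: (ltgtP u v) => // /psi_mono; rewrite e ltxx.
- by apply/forallP=> u; apply/forallP=> v; apply/implyP; apply: psi_mono.
- apply/forallP=> A; apply/implyP=> /hH[i ->].
  have -> : psi c @: (h i @: setT) = im (c i).
    by rewrite -imset_comp; apply: eq_imset => k /=; rewrite psih.
  exact: EG.
Qed.

(** * Consequences of being far from free *)

Lemma card_uniform (s : nat) (d : Order.disp_t) (V : finOrderType d)
    (G : {set {set V}}) : is_uniform s G -> #|G| <= #|V| ^ s.
Proof.
move=> /forallP Gs; rewrite -[s in _ ^ s]card_ord -card_ffun -cardsT.
have sub : G \subset [set g @: setT | g : {ffun 'I_s -> V}].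
  apply/subsetP=> e eG; have /implyP/(_ eG)/eqP es := Gs e.
  by have [h [_ <-]] := increasing_enumeration es; apply: imset_f.
by rewrite cardsT; apply: leq_trans (subset_leq_card sub) (leq_imset_card _ _).
Qed.

Lemma matching_gt0 (s : nat) (d : Order.disp_t) (U : finOrderType d)
    (H : {set {set U}}) : 0 < #|U| -> is_matching s H -> exists e, e \in H.
Proof.
case/card_gt0P=> u _ /andP[_ /forallP/(_ u)].
by case/cards1P=> e /setP/(_ e); rewrite inE set11 => /andP[eH _]; exists e.
Qed.

Local Open Scope ring_scope.

Section Far.

Variables (R : realType) (s : nat) (eps : R).
Variables (dU : Order.disp_t) (U : finOrderType dU) (H : {set {set U}}).
Variables (dV : Order.disp_t) (V : finOrderType dV) (G : {set {set V}}).
Hypotheses (U0 : (0 < #|U|)%N) (V0 : (0 < #|V|)%N).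
Hypotheses (Hm : is_matching s H) (far : is_far eps s H G).

(** Deleting all edges destroys all copies, since [H] has an edge. *)
Lemma far_le1 : is_uniform s G -> eps <= 1.
Proof.
move=> Gs; have [e eH] := matching_gt0 U0 Hm.
have GGfree : is_free H (G :\: G).
  case=> phi /and3P[_ _ /forallP/(_ e)/implyP/(_ eH)].
  by rewrite setDv inE.
have := far (subxx _) GGfree.
move=> /le_trans/(_ (_ : _ <= #|V|%:R ^+ s)).
rewrite -natrX ler_nat => /(_ (card_uniform Gs)).
by rewrite ger_pMl // ltr0n expn_gt0 V0.
Qed.

Lemma far_copy : 0 < eps -> (0 < #|copies H G|)%N.
Proof.
move=> eps0; rewrite lt0n; apply/negP => /eqP/cards0_eq no.
have Gfree : is_free H (G :\: set0).
  by rewrite setD0 => -[phi phiP]; have := in_set0 phi; rewrite -no inE phiP.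
have := far (sub0set _) Gfree.
by rewrite cards0 leNgt mulr_gt0 // exprn_gt0 // ltr0n.
Qed.

Lemma far_many_copies (M : nat) :
  (0 < s)%N -> 0 < eps -> 4 * #|U|%:R < eps * M%:R -> (M ^ #|U| <= #|V|)%N ->
  exists m N : nat, [/\ (m * s = #|U|)%N, (0 < N <= 3 * M ^ #|U|)%N &
    (eps / 2 / N%:R ^+ s) ^+ m * #|V|%:R ^+ #|U| <= #|copies H G|%:R].
Proof.
move=> s0 eps0 epsM MV.
have M0 : (0 < M)%N.
  rewrite lt0n; apply: contraTneq epsM => ->.
  by rewrite mulr0 -leNgt mulr_ge0 // ler0n.
set P := (M ^ #|U|)%N in MV *.
have P0 : (0 < P)%N by rewrite expn_gt0 M0.
pose w := (#|V| %/ P)%N; pose N := (#|V| %/ w).+1.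
have w0 : (0 < w)%N by rewrite divn_gt0.
have wP : (w * P <= #|V|)%N := leq_trunc_div _ _.
have VwN : (#|V| <= w * N)%N by rewrite mulnC ltnW // -ltn_divLR.
(* From [w >= 1], [#|V| < (w + 1) * P <= 2 * w * P], hence [N <= 2 * P + 1]. *)
have N3 : (N <= 3 * P)%N.
  have lt1 : (#|V| < w.+1 * P)%N by rewrite -ltn_divLR.
  have lt2 : (#|V| %/ w < 2 * P + 1)%N.
    rewrite ltn_divLR //; apply: leq_trans lt1 _; nia.
  by rewrite /N; lia.
have V0R : (0 : R) < #|V|%:R ^+ s by rewrite exprn_gt0 // ltr0n.
have N0R : (0 : R) < N%:R ^+ s by rewrite exprn_gt0 // ltr0n.
(* With this threshold the [N ^ s] boxes lose at most half of the [eps * #|V| ^ s] edges as poor;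
   [epsM] keeps the stuck edges below the other half. *)
pose a : R := eps / 2 / N%:R ^+ s * #|V|%:R ^+ s.
have a0 : 0 <= a by rewrite ltW // !mulr_gt0 ?invr_gt0.
have [D [DG leD copiesD]] :=
  few_deletions_or_many_copies G s0 Hm M0 w0 wP VwN a0.
have nfree : ~ is_free H (G :\: D).
  move=> /(far DG) farD.
  have := le_trans (ler_wpM2r (ler0n R M) farD) leD.
  have -> : N%:R ^+ s * a = eps / 2 * #|V|%:R ^+ s.
    by rewrite /a; field; rewrite gt_eqF.
  rewrite natrM natrX natrM.
  suff : 2 * #|U|%:R * #|V|%:R ^+ s < eps / 2 * M%:R * #|V|%:R ^+ s :> R by lra.
  by rewrite ltr_pM2r //; lra.
have [m mU le] := copiesD nfree.
exists m, N; split=> //.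
by move: le; rewrite /a exprMn -exprM -mU [(m * s)%N]mulnC.
Qed.

End Far.

(** * Choice of the constant *)

Theorem theorem1 (R : realType) (t : nat) :
  exists C : R, 0 < C /\
    forall (s : nat), (2 <= s)%N -> (s <= t)%N ->
    forall (eps : R), 0 < eps ->
    forall (dU : Order.disp_t) (U : finOrderType dU) (H : {set {set U}}),
      #|U| = t -> is_matching s H ->
    forall (n : nat) (dV : Order.disp_t) (V : finOrderType dV)
           (G : {set {set V}}),
      #|V| = n -> is_uniform s G ->
      is_far eps s H G ->
      (eps / C) `^ C * n%:R ^+ t <= #|copies H G|%:R.
Proof.
(* [c] has to be at least 6 and [4 * t + 1], to make [q] and [M * q] small, and at least
   [t * t + 2 * t] as an exponent. *)
have [c cP] : {c : nat | c = (t * t + 7 * t).+1} by exists (t * t + 7 * t).+1.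
exists c%:R; split=> [|s s2 st eps eps0 dU U H cU Hm n dV V G cV Gs far].
  by rewrite ltr0n cP.
have tc : (t * t <= c)%N by rewrite cP; lia.
have t2 : (2 <= t)%N := leq_trans s2 st.
have [n0|n0] := posnP n.
  by rewrite n0 expr0n gtn_eqF ?(ltnW t2) // mulr0 ler0n.
have U0 : (0 < #|U|)%N by rewrite cU ltnW.
have V0 : (0 < #|V|)%N by rewrite cV.
have eps1 := far_le1 U0 V0 Hm far Gs.
have [q qE] : {q | q = eps / c%:R} by exists (eps / c%:R).
have c0 : (0 : R) < c%:R by rewrite ltr0n cP.
have q0 : 0 < q by rewrite qE divr_gt0.
rewrite -qE powR_mulrn ?(ltW q0) //.
pose M := (Num.truncn (4 * t%:R / eps)).+1.
have M_gt : 4 * t%:R < eps * M%:R.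
  by rewrite -ltr_pdivrMl // mulrC truncnS_gt.
have Mq : M%:R * q <= 1.
  rewrite qE mulrA ler_pdivrMr // mul1r.
  have : M%:R <= 4 * t%:R / eps + 1 :> R.
    rewrite /M -[leLHS]natr1 lerD2r truncn_le // divr_ge0 ?mulr_ge0 ?ler0n //.
    exact: ltW.
  rewrite -(ler_pM2r eps0) mulrDl divfK ?gt_eqF // mul1r => /le_trans; apply.
  apply: (@le_trans _ _ (4 * t%:R + 1)); first by rewrite lerD2l.
  by rewrite -[4]/(4%:R) -natrM natr1 ler_nat cP; lia.
have q6 : 6 * q <= 1.
  rewrite qE mulrA ler_pdivrMr // mul1r.
  apply: (@le_trans _ _ 6); first by rewrite ler_piMr.
  by rewrite (ler_nat R 6) cP; lia.
have q1 : q <= 1 by lra.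
(* If [n < M ^ t], the bound is at most [(q * M) ^ (t * t) <= 1], and one copy suffices. *)
have [MV|VM] := leqP (M ^ #|U|) #|V|; last first.
  apply: (@le_trans _ _ 1); last first.
    by rewrite ler1n; apply: (far_copy V0 far eps0).
  apply: (@le_trans _ _ (q ^+ (t * t) * M%:R ^+ (t * t))); last first.
    by rewrite -exprMn mulrC exprn_ile1 // mulr_ge0 // ltW.
  apply: ler_pM; rewrite ?exprn_ge0 ?ler0n ?(ltW q0) //.
    by rewrite ler_wiXn2l ?(ltW q0).
  rewrite -!natrX ler_nat expnM leq_exp2r; last exact: ltnW.
  by rewrite -cV -cU ltnW.
rewrite -cU in M_gt.
have [m [N [mU /andP[N0 N3] le]]] :=
  far_many_copies U0 V0 Hm far (ltnW s2) eps0 M_gt MV.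
apply: le_trans le; rewrite cU cV ler_wpM2r ?exprn_ge0 ?ler0n //.
have N0R : (0 : R) < N%:R by rewrite ltr0n.
(* One factor [q] is at most [eps]. The others absorb [2 * N ^ s <= (2 * N) ^ s], because [q ^ (t +
   1) * 2 * N <= 6 * q * (M * q) ^ t <= 1]. *)
have one_edge : q ^+ (1 + s * t.+1) <= eps / 2 / N%:R ^+ s.
  rewrite ler_pdivlMr ?exprn_gt0 // ler_pdivlMr // exprD expr1.
  rewrite -!mulrA -[leRHS]mulr1; apply: ler_pM => //.
  - by rewrite ltW.
  - by rewrite !mulr_ge0 ?exprn_ge0 ?(ltW q0) ?ler0n.
  - by rewrite qE ler_pdivrMr // ler_peMr ?(ltW eps0) // ler1n cP.
  - apply: (@le_trans _ _ (q ^+ (s * t.+1) * (N%:R * 2) ^+ s)).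
      rewrite ler_wpM2l ?exprn_ge0 ?(ltW q0) // exprMn.
      rewrite ler_wpM2l ?exprn_ge0 ?(ltW N0R) //.
      by rewrite -[leLHS]expr1 ler_weXn2l ?(ltnW s2) // ler1n.
    rewrite mulnC exprM -exprMn exprn_ile1 ?mulr_ge0 ?exprn_ge0 ?(ltW q0) //.
    apply: (@le_trans _ _ (6 * q * (M%:R * q) ^+ t)).
      have : N%:R <= 3 * M%:R ^+ t :> R.
        by rewrite -[3]/(3%:R) -natrX -natrM ler_nat -cU.
      rewrite -(ler_pM2l (exprn_gt0 t.+1 q0)) => le3.
      by rewrite exprMn; move: le3; rewrite exprS; lra.
    by rewrite mulr_ile1 ?exprn_ile1 ?exprn_ge0 ?mulr_ge0 ?(ltW q0).
(* As [m * s = t], the total exponent is [m + t * (t + 1)], at most [c]. *)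
apply: (@le_trans _ _ ((q ^+ (1 + s * t.+1)) ^+ m)).
  rewrite -exprM ler_wiXn2l ?(ltW q0) // mulnDl mulnAC [(s * m)%N]mulnC mU cU.
  have : (m <= t)%N by rewrite -cU -mU leq_pmulr // ltnW.
  by rewrite cP; nia.
by rewrite lerXn2r ?nnegrE ?divr_ge0 ?exprn_ge0 ?(ltW q0) ?(ltW eps0) ?ler0n.
Qed.
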